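(* Let $r\ge 2$ be an integer and consider the functional equation \[ \varphi\Bigl(\sum_{j=0}^{r-1}\varphi(x-j)\Bigr)=x\qquad\text{for all } x\in\mathbb{R} \] for continuous nondecreasing functions $\varphi:\mathbb{R}\to\mathbb{R}$. Then the function $\varphi(x)=\frac{x}{\sqrt{r}}+\frac{\sqrt{r}-1}{2}$ is the unique nondecreasing affine solution of this equation. Moreover, every continuous nondecreasing solution $\varphi$ is a homeomorphism of $\mathbb{R}$ and satisfies \[ \varphi^{-1}(x)=\sum_{j=0}^{r-1}\varphi(x-j)\qquad\text{for all } x\in\mathbb{R}. \]
   Context: Solutions of the functional equation are sought among continuous nondecreasing functions $\mathbb{R}\to\mathbb{R}$. *)

(* Defs.v *)
From HB Require Import structures.
From mathcomp Require Import all_boot all_order all_algebra.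
From mathcomp Require Import all_classical all_reals all_analysis.

Set Implicit Arguments.
Unset Strict Implicit.
Unset Printing Implicit Defensive.

Import Order.TTheory GRing.Theory Num.Theory.
Import numFieldNormedType.Exports.

Local Open Scope ring_scope.

(* Solutions of the functional equation are by convention continuous and
   nondecreasing. *)
Definition is_solution (R : realType) (r : nat) (phi : R -> R) : Prop :=
  [/\ continuous phi, {homo phi : x y / x <= y}
    & forall x : R, phi (\sum_(j < r) phi (x - j%:R)) = x].

Definition is_affine (R : realType) (f : R -> R) : Prop :=
  exists a b : R, forall x : R, f x = a * x + b.

Definition homeomorphism_with_inverse (T U : topologicalType)
    (f : T -> U) (g : U -> T) : Prop :=
  [/\ continuous f, continuous g, cancel f g & cancel g f].

(* Main.v *)
(* Put F x = \sum_j phi (x - j), so that phi \o F = id.  By monotonicity of phi,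
   F (F (y / r)) <= y <= F (F (y / r) + r), so the continuous map F is onto by
   the intermediate value theorem, hence F \o phi = id as well.  For affine phi
   the equation reduces to two equations in the coefficients. *)
Require Import Defs.
From HB Require Import structures.
From mathcomp Require Import all_boot all_order all_algebra.
From mathcomp Require Import all_classical all_reals all_analysis.
From mathcomp Require Import ring lra.

Set Implicit Arguments.
Unset Strict Implicit.
Unset Printing Implicit Defensive.

Import Order.TTheory GRing.Theory Num.Theory.
Import numFieldNormedType.Exports.

Local Open Scope ring_scope.

Section Equation.
Context {R : realType}.

(** The shifts contribute [0 + 1 + ... + (n - 1)]; writing this with subtraction in [R] keeps the
    formula valid at [n = 0]. *)
Lemma sum_affine_shift (a b x : R) (n : nat) :
  \sum_(j < n) (a * (x - j%:R) + b) =
  n%:R * (a * x + b) - a * (n%:R * (n%:R - 1) / 2).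
Proof.
elim: n => [|n IHn]; first by rewrite big_ord0; field.
by rewrite big_ord_recr /= IHn -natr1; field.
Qed.

Lemma continuous_sum_shift (phi : R -> R) (n : nat) :
  continuous phi -> continuous (fun x : R => \sum_(j < n) phi (x - j%:R)).
Proof.
move=> cphi; apply: (@continuous_big _ _ +%R) => [|j _ x]; first exact: add_continuous.
apply: (@continuous_comp _ _ _ (fun y : R => y - j%:R) phi); last exact: cphi.
by apply: cvgB; [exact: cvg_id | exact: cvg_cst].
Qed.

Lemma solution_sum_onto (r : nat) (phi : R -> R) (y : R) :
  (0 < r)%N -> is_solution r phi -> exists x, \sum_(j < r) phi (x - j%:R) = y.
Proof.
move=> r_gt0 [cphi phi_le phiF].
set F := fun x : R => \sum_(j < r) phi (x - j%:R).
have rN0 : r%:R != 0 :> R by rewrite pnatr_eq0 -lt0n.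
(* Chosen so that [phi z = y / r]: then [r] copies of [phi z] add up to [y], and both bounds follow
   by comparing terms. *)
set z := F (y / r%:R).
have phiz : phi z = y / r%:R by exact: phiF.
have sum_phiz : \sum_(j < r) phi z = y.
  by rewrite sumr_const card_ord phiz -[LHS]mulr_natr divfK.
have Fz_le : F z <= y.
  rewrite -[leRHS]sum_phiz; apply: ler_sum => j _; apply: phi_le.
  by rewrite gerBl ler0n.
(* Since [j < r], every argument [z + r - j] is at least [z]. *)
have Fzr_ge : y <= F (z + r%:R).
  rewrite -[leLHS]sum_phiz; apply: ler_sum => j _; apply: phi_le.
  by rewrite -addrA lerDl subr_ge0 ler_nat ltnW.
have z_le : z <= z + r%:R by rewrite lerDl ler0n.
have F_le : F z <= F (z + r%:R) by exact: le_trans Fz_le Fzr_ge.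
have [||c _ <-] := @IVT R F z (z + r%:R) y z_le; last by exists c.
  exact/continuous_subspaceT/continuous_sum_shift.
by rewrite minEle maxEle F_le Fz_le.
Qed.

Lemma affine_is_solution (r : nat) :
  (0 < r)%N -> is_solution r
    (fun x : R => x / Num.sqrt r%:R + (Num.sqrt r%:R - 1) / 2).
Proof.
move=> r_gt0; set s : R := Num.sqrt r%:R.
have s_gt0 : 0 < s by rewrite sqrtr_gt0 ltr0n.
have sN0 : s != 0 by rewrite gt_eqF.
(* With [r] replaced by [s ^+ 2], the equation becomes a rational identity in [s] and [x]. *)
have rE : r%:R = s ^+ 2 by rewrite sqr_sqrtr.
split=> [x|x y xy|x].
- by apply: cvgD; [apply: cvgMr_tmp; exact: cvg_id | exact: cvg_cst].
- by rewrite lerD2r ler_pM2r ?invr_gt0.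
- under eq_bigr do rewrite [_ / s]mulrC.
  by rewrite sum_affine_shift rE; field.
Qed.

(** The values at [0] and [1] suffice: their difference gives [a ^+ 2 * r = 1], monotonicity fixes
    the sign of [a], and the value at [0] then gives [b]. *)
Lemma affine_solution_coef (r : nat) (a b : R) :
  (0 < r)%N -> is_solution r (fun x : R => a * x + b) ->
  a = (Num.sqrt r%:R)^-1 /\ b = (Num.sqrt r%:R - 1) / 2.
Proof.
move=> r_gt0 [_ phi_le phiF]; set s : R := Num.sqrt r%:R.
have s_gt0 : 0 < s by rewrite sqrtr_gt0 ltr0n.
have sN0 : s != 0 by rewrite gt_eqF.
have rE : r%:R = s ^+ 2 by rewrite sqr_sqrtr.
have a_ge0 : 0 <= a by have := phi_le 0 1 ler01; lra.
have := phiF 0; have := phiF 1; rewrite !sum_affine_shift rE => E1 E0.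
have /eqP as_sq : (a * s) ^+ 2 == 1 ^+ 2.
  (* Writing [1] as [1 - 0] and expanding by [E1] and [E0] subtracts the two equations, which
     cancels [b]. *)
  by apply/eqP; rewrite expr1n -[RHS](subr0 1) -[in RHS]E1 -[in RHS]E0; ring.
have as1 : a * s = 1.
  by apply/eqP; rewrite -(@eqrXn2 _ 2) ?as_sq ?mulr_ge0 // ltW.
have aE : a = s^-1 by rewrite -[LHS](mulfK sN0) as1 mul1r.
(* In [E0] the coefficient of [b] is [a * r + 1], which equals [s + 1]. *)
split=> //; apply: (@mulIf _ (s + 1)); first by rewrite gt_eqF// addr_gt0.
move: E0; rewrite aE => E0.
have : b * (s + 1) - (s - 1) / 2 * (s + 1) = 0 by rewrite -[RHS]E0; field.
by move/eqP; rewrite subr_eq0 => /eqP.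
Qed.

End Equation.

Theorem theorem2p1 (R : realType) (r : nat) (hr : (2 <= r)%N) :
  unique (fun phi : R -> R => is_affine phi /\ is_solution r phi)
    (fun x : R => x / Num.sqrt r%:R + (Num.sqrt r%:R - 1) / 2)
  /\
  (forall phi : R -> R, is_solution r phi ->
     exists phi_inv : R -> R,
       homeomorphism_with_inverse phi phi_inv /\
       forall x : R, phi_inv x = \sum_(j < r) phi (x - j%:R)).
Proof.
have r_gt0 : (0 < r)%N by exact: ltnW.
split; first split.
- split; last exact: affine_is_solution.
  exists (Num.sqrt r%:R)^-1, ((Num.sqrt r%:R - 1) / 2) => x.
  by rewrite [_ / Num.sqrt _]mulrC.
- move=> phi [[a [b phiE]]]; have -> : phi = fun x => a * x + b by exact/funext.
  move=> /(affine_solution_coef r_gt0)[-> ->]; apply/funext => x.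
  by rewrite [_ / Num.sqrt _]mulrC.
- move=> phi sol; exists (fun x => \sum_(j < r) phi (x - j%:R)); split=> //.
  have [cphi _ phiF] := sol; split=> //; first exact: continuous_sum_shift.
  (* A right inverse of [phi] that is onto is also a left inverse: at a point [F y],
     [F (phi (F y)) = F y]. *)
  by move=> x; have [y <-] := solution_sum_onto x r_gt0 sol; rewrite phiF.
Qed.
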